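(* Let $\mathcal{F}:\mathbb{F}_{q^t}^r\to\mathbb{F}_q^{rt}$ be a vfr-map and let $\phi\in\Gamma\mathrm{L}(rt,q)$ stabilise every member of the Desarguesian vector space partition of $\mathbb{F}_q^{rt}$ obtained from $\mathcal{F}$. Then $\phi=\mathcal{F}(m_\beta)$ for some $\beta\in\mathbb{F}_{q^t}^*$, where $m_\beta\in\mathrm{GL}(r,q^t)$ is the map $v\mapsto\beta v$.
   Context: A vfr-map $\mathcal{F}:\mathbb{F}_{q^t}^r\to\mathbb{F}_q^{rt}$ is an $\mathbb{F}_q$-linear bijection (e.g. obtained by fixing an $\mathbb{F}_q$-basis of $\mathbb{F}_{q^t}$ and writing coordinates in it). The Desarguesian vector space partition obtained from $\mathcal{F}$ is the set of $t$-dimensional $\mathbb{F}_q$-subspaces $\{\mathcal{F}(\alpha v)\mid\alpha\in\mathbb{F}_{q^t}\}$, $v\in\mathbb{F}_{q^t}^r\setminus\{0\}$. For $\xi\in\Gamma\mathrm{L}(r,q^t)$, $\mathcal{F}(\xi)$ denotes the map on $\mathbb{F}_q^{rt}$ with $\mathcal{F}(\xi)(\mathcal{F}(v))=\mathcal{F}(\xi(v))$.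
   Formalization: The formal theorem assumes r ≥ 2; for r = 1 the partition has the whole space as its only member and the claim fails, e.g. q = t = 2, where GL(2,2) has 6 elements but only 3 are multiplications by elements of F_4^*. *)

(* Defs.v *)
From HB Require Import structures.
From mathcomp Require Import all_boot all_order all_algebra all_field.
From mathcomp Require Import mathcomp_extra boolp classical_sets functions.

Set Implicit Arguments.
Unset Strict Implicit.
Unset Printing Implicit Defensive.

Import GRing.Theory.
Local Open Scope classical_set_scope.
Local Open Scope ring_scope.

Definition GammaL (K : fieldType) (n : nat) : set ('rV[K]_n -> 'rV[K]_n) :=
  [set xi : 'rV[K]_n -> 'rV[K]_n | bijective xi /\
     exists2 sigma : {rmorphism K -> K}, bijective sigma &
       forall (a : K) (u v : 'rV[K]_n), xi (a *: u + v) = sigma a *: xi u + xi v].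

Definition GL (K : fieldType) (n : nat) : set ('rV[K]_n -> 'rV[K]_n) :=
  [set xi : 'rV[K]_n -> 'rV[K]_n | bijective xi /\ linear xi].

(* Scalars of [F] act on ['rV[L]_r] through the embedding [a |-> a%:A] of [F]
   in [L]; the library only equips ['rV[L]_r] with its [L]-module structure. *)
Definition is_vfr_map (F : fieldType) (L : fieldExtType F) (r n : nat)
    (f : 'rV[L]_r -> 'rV[F]_n) : Prop :=
  bijective f /\
  forall (a : F) (u v : 'rV[L]_r), f (a%:A *: u + v) = a *: f u + f v.

Definition desarguesian_partition (F : fieldType) (L : fieldExtType F)
    (r n : nat) (f : 'rV[L]_r -> 'rV[F]_n) : set (set 'rV[F]_n) :=
  [set range (fun alpha : L => f (alpha *: v)) | v in [set v | v != 0]].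

(* The map [f o xi o f^-1]; the default value of the pseudo-inverse is irrelevant when
   [f] is a vfr-map, see [vfr_liftP]. *)
Definition vfr_lift (F : fieldType) (L : fieldExtType F) (r n : nat)
    (f : 'rV[L]_r -> 'rV[F]_n) (xi : 'rV[L]_r -> 'rV[L]_r) :
    'rV[F]_n -> 'rV[F]_n :=
  fun w => f (xi ('pinv_(fun=> 0) [set: 'rV[L]_r] f w)).

Definition scalar_map (K : fieldType) (n : nat) (beta : K) :
  'rV[K]_n -> 'rV[K]_n := fun v => beta *: v.
Arguments scalar_map {K} n beta _.

Lemma vfr_liftP (F : fieldType) (L : fieldExtType F) (r n : nat)
    (f : 'rV[L]_r -> 'rV[F]_n) (xi : 'rV[L]_r -> 'rV[L]_r)
    (psi : 'rV[F]_n -> 'rV[F]_n) : is_vfr_map f ->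
  psi = vfr_lift f xi <-> forall v, psi (f v) = f (xi v).
Proof.
case=> f_bij _; have fK v : 'pinv_(fun=> 0) [set: 'rV[L]_r] f (f v) = v.
  by apply: pinvKV; rewrite ?inE // => x y _ _; apply: bij_inj.
split=> [-> v|psiE]; first by rewrite /vfr_lift fK.
have [g _ gK] := f_bij.
by apply/funext => w; rewrite -(gK w) psiE /vfr_lift fK.
Qed.

Lemma scalar_map_GL (K : fieldType) (n : nat) (beta : K) :
  beta != 0 -> GL (scalar_map n beta).
Proof.
move=> beta0; split.
  by exists (scalar_map n beta^-1) => v; rewrite /scalar_map scalerA
    ?mulVf ?mulfV ?scale1r.
by move=> a u v; rewrite /scalar_map scalerDr !scalerA mulrC.
Qed.

(* Main.v *)
(** The conjugate [psi] of [phi] by [f] is an additive map of [L^r] sending every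
    vector [v] into the line [L v]. As [r > 1], comparing the scalars by which
    [psi] acts on [a e_i], [e_j] and [a e_i + e_j] for [i != j] shows that they
    all agree. *)
Require Import Defs.
From HB Require Import structures.
From mathcomp Require Import all_boot all_order all_algebra all_field.
From mathcomp Require Import mathcomp_extra boolp classical_sets functions.

Import GRing.Theory.
Local Open Scope classical_set_scope.
Local Open Scope ring_scope.

(** In [psi (a e_i + e_j) = k (a e_i + e_j)], coordinate [j] pins [k] to the multiplier of [e_j],
    whatever [a] is; coordinate [i] then yields [b * a = k * a]. Since [b] itself is never equated
    with [k], the case [a = 0] needs no separate treatment. *)
Lemma line_preserving_delta {K : fieldType} {n : nat}
    {psi : 'rV[K]_n -> 'rV[K]_n} (psiD : {morph psi : u v / u + v})
    (psi_line : forall v, exists k, psi v = k *: v)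
    {i j : 'I_n} (ij : i != j) (a : K) :
  psi (a *: delta_mx 0 i) = (psi (delta_mx 0 j) 0 j * a) *: delta_mx 0 i.
Proof.
have [k] := psi_line (a *: delta_mx 0 i + delta_mx 0 j).
have [b psi_ei] := psi_line (a *: delta_mx 0 i).
have [c psi_ej] := psi_line (delta_mx 0 j).
rewrite psiD psi_ei psi_ej scalerDr => /rowP E.
have := E i; have := E j.
rewrite !mxE !eqxx (negPf ij) eq_sym (negPf ij) !(mulr0, mulr1, addr0, add0r).
by move=> -> <-; rewrite scalerA.
Qed.

(** Additivity suffices because one multiplier serves all vectors [a e_i], not just the [e_i]:
    summing over coordinates never requires pulling a scalar out of [psi]. *)
Lemma additive_line_preserving_scalar {K : fieldType} {n : nat}
    {psi : 'rV[K]_n -> 'rV[K]_n} (psiD : {morph psi : u v / u + v})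
    (psi_line : forall v, exists k, psi v = k *: v) (n_gt1 : (1 < n)%N) :
  exists beta, forall v, psi v = beta *: v.
Proof.
pose i0 := Ordinal (ltnW n_gt1); pose i1 := Ordinal n_gt1.
pose e i : 'rV[K]_n := delta_mx 0 i.
have psi_e := line_preserving_delta psiD psi_line.
have diag i j : i != j -> psi (e i) 0 i = psi (e j) 0 j.
  move=> ij; rewrite -[e i in LHS]scale1r (psi_e _ _ ij) !mxE.
  by rewrite !eqxx !mulr1.
have psi_delta i a : psi (a *: e i) = psi (e i0) 0 i0 *: (a *: e i).
  (* Only distinct indices can be compared, so [i0] itself is reached through [i1]. *)
  rewrite scalerA; have [->|ii0] := eqVneq i i0.
    by rewrite (psi_e i0 i1) // (diag i0 i1).
  by rewrite (psi_e _ _ ii0).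
have psi0 : psi 0 = 0 by have [k ->] := psi_line 0; rewrite scaler0.
exists (psi (e i0) 0 i0) => v.
rewrite [v in LHS]row_sum_delta (big_morph psi psiD psi0).
by rewrite [v in RHS]row_sum_delta scaler_sumr; apply: eq_bigr.
Qed.

Theorem theorem2p6 (q r t : nat) (F : finFieldType) (L : fieldExtType F)
    (card_F : #|F| = q) (dim_L : \dim {:L} = t) (r_gt1 : (1 < r)%N)
    (f : 'rV[L]_r -> 'rV[F]_(r * t)) (vfr_f : is_vfr_map f)
    (phi : 'rV[F]_(r * t) -> 'rV[F]_(r * t)) (GammaL_phi : GammaL phi)
    (stab_phi : forall S : set 'rV[F]_(r * t),
       desarguesian_partition f S -> phi @` S = S) :
  exists2 beta : L, beta != 0 & phi = vfr_lift f (scalar_map r beta).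
Proof.
have [[g fK gK] f_lin] := vfr_f.
have [phi_bij [sigma _ phi_lin]] := GammaL_phi.
have fD u v : f (u + v) = f u + f v.
  by have := f_lin 1 u v; rewrite !scale1r.
have phiD u v : phi (u + v) = phi u + phi v.
  by have := phi_lin 1 u v; rewrite rmorph1 !scale1r.
have f0 : f 0 = 0 by apply: (addrI (f 0)); rewrite -fD !addr0.
have phi0 : phi 0 = 0 by apply: (addrI (phi 0)); rewrite -phiD !addr0.
pose psi v := g (phi (f v)).
have psiD : {morph psi : u v / u + v}.
  by move=> u v; apply: (can_inj fK); rewrite /psi fD phiD fD !gK.
have psi_line v : exists k, psi v = k *: v.
  (* Members of the partition come from nonzero vectors, so [v = 0] is treated apart. *)
  have [->|v0] := eqVneq v 0.
    by exists 0; apply: (can_inj fK); rewrite /psi f0 phi0 gK scaler0 f0.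
  have lineP : desarguesian_partition f (range (fun k : L => f (k *: v))).
    by exists v.
  (* [f v] is the point with scalar [1] of its member, which [phi] maps onto itself. *)
  have : (phi @` range (fun k : L => f (k *: v))) (phi (f v)).
    by exists (f v) => //; exists 1; rewrite ?scale1r.
  by rewrite (stab_phi _ lineP) => -[k _ fkv]; exists k; rewrite /psi -fkv fK.
have [beta psiE] := additive_line_preserving_scalar psiD psi_line r_gt1.
have phi_f v : phi (f v) = f (beta *: v) by rewrite -psiE gK.
exists beta; last exact/(vfr_liftP _ _ vfr_f).
(* If [beta = 0], then [phi] vanishes on the range of [f], so injectivity would identify a basis
   vector with [0]. *)
apply/eqP => beta0; have /(bij_inj phi_bij)/(can_inj fK) :
    phi (f (delta_mx 0 (Ordinal r_gt1))) = phi (f 0).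
  by rewrite !phi_f beta0 !scale0r.
by move/rowP/(_ (Ordinal r_gt1))/eqP; rewrite !mxE !eqxx oner_eq0.
Qed.
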